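(* Let $\mathfrak{C}$ be an $A$-coring. If $g$ is a Galois grouplike element of $\mathfrak{C}$ such that $\mathscr{D}^1(\mathfrak{C},g)=\{1\}$, then there is an isomorphism of groups $$\mathbf{Aut}(\mathfrak{C})\cong U(A)_g/U(A^g).$$
   Context: $K$ is a commutative ring and $A$ an (associative unital) $K$-algebra; $U(-)$ denotes the group of units of a ring. An $A$-coring is an $A$-bimodule $\mathfrak{C}$ with $A$-bimodule maps $\Delta:\mathfrak{C}\to\mathfrak{C}\otimes_A\mathfrak{C}$ and $\varepsilon:\mathfrak{C}\to A$ satisfying the coassociativity and counit axioms. $\mathbf{Aut}(\mathfrak{C})$ is the group of $A$-coring automorphisms of $\mathfrak{C}$ (bijective $A$-bimodule maps compatible with $\Delta$ and $\varepsilon$). A grouplike element is $g\in\mathfrak{C}$ with $\Delta(g)=g\otimes_A g$ and $\varepsilon(g)=1$; $\mathbf{Gr}(\mathfrak{C})$ is the set of these. For $g\in\mathbf{Gr}(\mathfrak{C})$, $A^g=\{a\in A: ag=ga\}$. A grouplike $g$ is Galois if the canonical map $A\otimes_{A^g}A\to\mathfrak{C}$, $a\otimes a'\mapsto aga'$, is bijective. The group $U(A)$ acts on $\mathbf{Gr}(\mathfrak{C})$ by $(\alpha,g)\mapsto\alpha g\alpha^{-1}$; $\mathscr{D}^1(\mathfrak{C},g)$ is the set of orbits, pointed by the orbit of $g$, and $\mathscr{D}^1(\mathfrak{C},g)=\{1\}$ means that there is only one orbit. $U(A)_g=\{\alpha\in U(A):\alpha A^g=A^g\alpha\}$, a subgroup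 of $U(A)$ containing $U(A^g)$ as a normal subgroup. *)

(* Defs.v *)
From HB Require Import structures.
From mathcomp Require Import all_boot all_algebra.
From mathcomp Require Import boolp classical_sets.
From mathcomp Require Import freeg.

Set Implicit Arguments.
Unset Strict Implicit.
Unset Printing Implicit Defensive.

Import GRing.Theory.

Local Open Scope ring_scope.
Local Open Scope quotient_scope.

Reserved Notation "x :*r a" (at level 40, left associativity).
Reserved Notation "x ⊗ y" (at level 40, left associativity).
Reserved Notation "M ⊗_ A N" (at level 40, A at level 2, left associativity).

HB.mixin Record isNormalized (G : groupType) (S : {pred G}) := {
  gpred_normal : forall x y : G, x \in S -> (x ^ y)%g \in S
}.

#[short(type="normalClosed")]
HB.structure Definition NormalClosed (G : groupType) :=
  {S of GroupClosed G S & isNormalized G S}.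

Module GQuotient.
Section GQuotient.

Local Open Scope group_scope.

Variables (G : groupType) (N : normalClosed G).

Definition equiv (x y : G) := x^-1 * y \in N.

Lemma equiv_is_equiv : equiv_class_of equiv.
Proof.
split=> [x|x y|y x z]; rewrite /equiv ?mulVg ?gpred1 //.
  by rewrite -gpredV invgM invgK.
by move=> xy yz; rewrite -[z](mulVKg y) mulgA gpredM.
Qed.

Canonical equiv_equiv := EquivRelPack equiv_is_equiv.
Canonical equiv_encModRel := defaultEncModRel equiv.

Definition quot := {eq_quot equiv}.

#[export]
HB.instance Definition _ : EqQuotient G equiv quot := EqQuotient.on quot.
#[export]
HB.instance Definition _ := Choice.on quot.

Definition one : quot := lift_cst quot 1.
Definition mul := lift_op2 quot *%g.
Definition inv := lift_op1 quot (fun x => x^-1).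

Canonical pi_one_morph := PiConst one.

Lemma pi_inv : {morph \pi : x / x^-1 >-> inv x}.
Proof.
move=> x /=; unlock inv; apply/eqP; rewrite piE /= /equiv.
have /eqP : x = repr (\pi_quot x) %[mod quot] by rewrite reprK.
rewrite piE /equiv; set x' := repr _ => hx.
have -> : x^-1^-1 * x'^-1 = ((x^-1 * x') ^ x^-1)^-1.
  by rewrite /conjg !invgM !invgK !mulgA mulgK.
by rewrite gpredV; apply: gpred_normal.
Qed.
Canonical pi_inv_morph := PiMorph1 pi_inv.

Lemma pi_mul : {morph \pi : x y / x * y >-> mul x y}.
Proof.
move=> x y /=; unlock mul; apply/eqP; rewrite piE /= /equiv.
have /eqP : x = repr (\pi_quot x) %[mod quot] by rewrite reprK.
have /eqP : y = repr (\pi_quot y) %[mod quot] by rewrite reprK.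
rewrite !piE /equiv; set y' := repr _; set x' := repr _ => hy hx.
have -> : (x * y)^-1 * (x' * y') = (x^-1 * x') ^ y * (y^-1 * y').
  by rewrite /conjg invgM !mulgA mulgK.
by rewrite gpredM // gpred_normal.
Qed.
Canonical pi_mul_morph := PiMorph2 pi_mul.

Lemma mulqA : associative mul.
Proof. by move=> x y z; rewrite -[x]reprK -[y]reprK -[z]reprK !piE mulgA. Qed.

Lemma mul1q : left_id one mul.
Proof. by move=> x; rewrite -[x]reprK !piE mul1g. Qed.

Lemma mulq1 : right_id one mul.
Proof. by move=> x; rewrite -[x]reprK !piE mulg1. Qed.

Lemma mulVq : left_inverse one inv mul.
Proof. by move=> x; rewrite -[x]reprK !piE mulVg. Qed.

Lemma mulqV : right_inverse one inv mul.
Proof. by move=> x; rewrite -[x]reprK !piE mulgV. Qed.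

#[export]
HB.instance Definition _ := isGroup.Build quot mulqA mul1q mulq1 mulVq mulqV.

End GQuotient.
Module Exports. HB.reexport. End Exports.
End GQuotient.
Export GQuotient.Exports.

Notation gquot := GQuotient.quot.

Definition group_isomorphic (G H : groupType) : Prop :=
  exists f : {multiplicative G -> H}, bijective f.

(* GRing.unit needs a unitRingType, hence a nonzero ring with a decidable set of
   units; here A is arbitrary. *)
Record units (A : pzRingType) := Units {
  uval : A;
  uinv : A;
  uvalV : uval * uinv = 1;
  uVval : uinv * uval = 1
}.

Lemma units_inj (A : pzRingType) (u v : units A) : uval u = uval v -> u = v.
Proof.
case: u v => [u u' uV Vu] [v v' vV Vv] /= e; subst v.
have e : u' = v' by rewrite -[u']mulr1 -vV mulrA Vu mul1r.
by subst v'; congr Units; apply: Prop_irrelevance.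
Qed.

HB.instance Definition _ (A : pzRingType) := gen_eqMixin (units A).
HB.instance Definition _ (A : pzRingType) := gen_choiceMixin (units A).

Section UnitsGroup.
Variable A : pzRingType.
Implicit Types u v w : units A.

Definition units1 : units A := Units (mulr1 1) (mulr1 1).

Definition unitsV u : units A := Units (uVval u) (uvalV u).

Fact unitsM_subproof1 u v : (uval u * uval v) * (uinv v * uinv u) = 1.
Proof. by rewrite mulrA -[_ * uinv v]mulrA uvalV mulr1 uvalV. Qed.

Fact unitsM_subproof2 u v : (uinv v * uinv u) * (uval u * uval v) = 1.
Proof. by rewrite mulrA -[_ * uval u]mulrA uVval mulr1 uVval. Qed.

Definition unitsM u v : units A :=
  Units (unitsM_subproof1 u v) (unitsM_subproof2 u v).

Fact unitsMA : associative unitsM.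
Proof. by move=> u v w; apply: units_inj; rewrite /= mulrA. Qed.
Fact units1M : left_id units1 unitsM.
Proof. by move=> u; apply: units_inj; rewrite /= mul1r. Qed.
Fact unitsM1 : right_id units1 unitsM.
Proof. by move=> u; apply: units_inj; rewrite /= mulr1. Qed.
Fact unitsVM : left_inverse units1 unitsV unitsM.
Proof. by move=> u; apply: units_inj; rewrite /= uVval. Qed.
Fact unitsMV : right_inverse units1 unitsV unitsM.
Proof. by move=> u; apply: units_inj; rewrite /= uvalV. Qed.

HB.instance Definition _ :=
  isGroup.Build (units A) unitsMA units1M unitsM1 unitsVM unitsMV.

End UnitsGroup.

(* M ⊗_R N for a right action ra of R on M and a left action la of R on N: the
   free abelian group on M * N modulo the usual relations. The definition does
   not use the ring structure of R. *)
Section Tensor.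
Variables (M N : zmodType) (R : Type) (ra : M -> R -> M) (la : R -> N -> N).

Local Notation free := {freeg (M * N)%type / int}.

Inductive tens_rel : free -> Prop :=
| tens_rel0 : tens_rel 0
| tens_relB x y : tens_rel x -> tens_rel y -> tens_rel (x - y)
| tens_relDl m m' n :
    tens_rel (<< (m + m', n) >> - << (m, n) >> - << (m', n) >>)
| tens_relDr m n n' :
    tens_rel (<< (m, n + n') >> - << (m, n) >> - << (m, n') >>)
| tens_relA m r n : tens_rel (<< (ra m r, n) >> - << (m, la r n) >>).

Definition tens_ker : {pred free} := fun x => `[< tens_rel x >].

Fact tens_ker_closed : zmod_closed tens_ker.
Proof.
split=> [|x y /asboolP hx /asboolP hy]; apply/asboolP; first exact: tens_rel0.
exact: tens_relB.
Qed.
HB.instance Definition _ := GRing.isZmodClosed.Build free tens_ker tens_ker_closed.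

Definition tens : Type := Quotient.quot tens_ker.
HB.instance Definition _ : EqQuotient free (Quotient.equiv tens_ker) tens :=
  EqQuotient.on tens.
HB.instance Definition _ := Choice.on tens.

Definition balanced (G : zmodType) (f : M -> N -> G) : Prop :=
  [/\ forall m m' n, f (m + m') n = f m n + f m' n,
      forall m n n', f m (n + n') = f m n + f m n' &
      forall m r n, f (ra m r) n = f m (la r n)].

End Tensor.

(* The group operations of M ⊗_R N, tpure and tlift are locked to keep
   unification from unfolding them. *)
HB.lock Definition tens_zero (M N : zmodType) R (ra : M -> R -> M) (la : R -> N -> N) :
  tens ra la := 0 :> Quotient.quot (tens_ker ra la).

HB.lock Definition tens_opp (M N : zmodType) R (ra : M -> R -> M) (la : R -> N -> N)
  (s : tens ra la) : tens ra la := - (s : Quotient.quot (tens_ker ra la)).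

HB.lock Definition tens_add (M N : zmodType) R (ra : M -> R -> M) (la : R -> N -> N)
  (s t : tens ra la) : tens ra la :=
  (s : Quotient.quot (tens_ker ra la)) + (t : Quotient.quot (tens_ker ra la)).

HB.lock Definition tpure (M N : zmodType) R (ra : M -> R -> M) (la : R -> N -> N)
  (m : M) (n : N) : tens ra la :=
  \pi_(tens ra la) (<< (m, n) >> : {freeg (M * N)%type / int}).

(* The additive map M ⊗_R N -> G induced by f; see tliftD and tliftE. It is
   meaningful only for balanced f. *)
HB.lock Definition tlift (M N : zmodType) R (ra : M -> R -> M) (la : R -> N -> N)
  (G : zmodType) (f : M -> N -> G) (t : tens ra la) : G :=
  fglift (fun p => f p.1 p.2 : zmodule G) (repr t).

Section TensorZmodule.
Variables (M N : zmodType) (R : Type) (ra : M -> R -> M) (la : R -> N -> N).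
Local Notation free := {freeg (M * N)%type / int}.
Local Notation tens := (tens ra la).
Local Notation Q := (Quotient.quot (tens_ker ra la)).

Fact tens_addA : associative (@tens_add M N R ra la).
Proof. by rewrite unlock; exact: (@addrA Q). Qed.
Fact tens_addC : commutative (@tens_add M N R ra la).
Proof. by rewrite unlock; exact: (@addrC Q). Qed.
Fact tens_add0 : left_id (tens_zero ra la) (@tens_add M N R ra la).
Proof. by rewrite !unlock; exact: (@add0r Q). Qed.
Fact tens_addN : left_inverse (tens_zero ra la) (@tens_opp M N R ra la)
  (@tens_add M N R ra la).
Proof. by rewrite !unlock; exact: (@addNr Q). Qed.
HB.instance Definition _ :=
  GRing.isZmodule.Build tens tens_addA tens_addC tens_add0 tens_addN.

Definition pi_tens (x : free) : tens := \pi_tens x.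

Fact pi_tens_zmod : zmod_morphism pi_tens.
Proof.
move=> x y.
transitivity (tens_add (pi_tens x) (tens_opp (pi_tens y))); last by [].
rewrite tens_add.unlock tens_opp.unlock; exact: (raddfB (\pi_Q : free -> Q)).
Qed.
HB.instance Definition _ := GRing.isZmodMorphism.Build free tens pi_tens pi_tens_zmod.

End TensorZmodule.

Section TensorTheory.
Variables (M N : zmodType) (R : Type) (ra : M -> R -> M) (la : R -> N -> N).
Local Notation free := {freeg (M * N)%type / int}.
Local Notation tens := (tens ra la).
Local Notation "m ⊗ n" := (tpure ra la m n).

Lemma tpure_eq (x y : free) : tens_rel ra la (x - y) -> pi_tens ra la x = pi_tens ra la y.
Proof.
by move=> h; apply/eqP; rewrite -Quotient.idealrBE; apply/asboolP.
Qed.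

Lemma tpure_pi m n : m ⊗ n = pi_tens ra la << (m, n) >>.
Proof. by rewrite tpure.unlock. Qed.

Lemma tpure_balanced : balanced ra la (tpure ra la).
Proof.
split=> [m m' n|m n n'|m r n]; rewrite !tpure_pi.
- by rewrite -raddfD; apply: tpure_eq; rewrite opprD addrA; apply: tens_relDl.
- by rewrite -raddfD; apply: tpure_eq; rewrite opprD addrA; apply: tens_relDr.
- by apply: tpure_eq; apply: tens_relA.
Qed.

Lemma tpureDl m m' n : (m + m') ⊗ n = m ⊗ n + m' ⊗ n.
Proof. by case: tpure_balanced. Qed.

Lemma tpureDr m n n' : m ⊗ (n + n') = m ⊗ n + m ⊗ n'.
Proof. by case: tpure_balanced. Qed.

Lemma tpureA m r n : ra m r ⊗ n = m ⊗ la r n.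
Proof. by case: tpure_balanced. Qed.

Lemma tpure0l n : 0 ⊗ n = 0.
Proof. by apply: (addrI (0 ⊗ n)); rewrite -tpureDl !addr0. Qed.

Lemma tpureNl m n : (- m) ⊗ n = - (m ⊗ n).
Proof. by apply: (addrI (m ⊗ n)); rewrite -tpureDl !subrr tpure0l. Qed.

Lemma tens_ind (P : tens -> Prop) :
  P 0 -> (forall x y, P x -> P y -> P (x + y)) -> (forall m n, P (m ⊗ n)) ->
  forall t, P t.
Proof.
move=> P0 PD Pp; elim/quotW => D; rewrite -/(pi_tens ra la D).
elim/freeg_ind_dom0: D; first by rewrite raddf0.
move=> k [m n] D _ _ PDD; rewrite raddfD; apply: (PD) => //.
have PMn m' j : P ((m' ⊗ n) *+ j).
  by elim: j => [|j IH]; rewrite ?mulr0n // mulrS; apply: PD.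
have -> : << k *g (m, n) >> = << (m, n) >> *~ k :> free.
  by rewrite freegU_mulz intz.
rewrite raddfMz /= -tpure_pi.
case: k => j; first by rewrite -pmulrn; apply: PMn.
by rewrite NegzE -nmulrn -mulNrn -tpureNl; apply: PMn.
Qed.

Section Lift.
Variables (G : zmodType) (f : M -> N -> G).
Hypothesis fP : balanced ra la f.

Local Notation F := (fglift (fun p => f p.1 p.2 : zmodule G)).

Fact fglift_pure m n : F (<< (m, n) >> : free) = f m n.
Proof. by rewrite liftU /= scale1r. Qed.

Fact fglift_rel x : tens_rel ra la x -> F x = 0.
Proof.
have FB : {morph F : x y / x - y} by exact: lift_is_additive.
case: fP => fDl fDr fA.
elim=> {x} [|x y _ hx _ hy|m m' n|m n n'|m r n].
- by rewrite -(subrr 0) FB subrr.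
- by rewrite FB hx hy subrr.
- by rewrite !FB !fglift_pure fDl addrAC addrK subrr.
- by rewrite !FB !fglift_pure fDr addrAC addrK subrr.
- by rewrite !FB !fglift_pure fA subrr.
Qed.

Fact tlift_pi (x : free) : tlift f (pi_tens ra la x) = F x.
Proof.
have FB : {morph F : x y / x - y} by exact: lift_is_additive.
have /eqP : repr (\pi_tens x) = x %[mod tens] by rewrite reprK.
rewrite -Quotient.idealrBE => /asboolP/fglift_rel; rewrite tlift.unlock FB.
by move/eqP; rewrite subr_eq0 => /eqP.
Qed.

Lemma tliftD : {morph (tlift f : tens -> G) : x y / x + y}.
Proof.
have FB : {morph F : x y / x - y} by exact: lift_is_additive.
have FN : {morph F : x / - x}.
  by move=> x; rewrite -[- x]add0r FB -(subrr 0) FB subrr add0r.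
move=> s t; elim/quotW: s => x; elim/quotW: t => y.
rewrite -/(pi_tens ra la x) -/(pi_tens ra la y).
by rewrite -raddfD !tlift_pi -{1}[y]opprK FB FN opprK.
Qed.

Lemma tliftE m n : tlift f (m ⊗ n : tens) = f m n.
Proof. by rewrite tpure_pi tlift_pi fglift_pure. Qed.

End Lift.

Lemma tens_ext (G : zmodType) (u v : tens -> G) :
  {morph u : x y / x + y} -> {morph v : x y / x + y} ->
  (forall m n, u (m ⊗ n) = v (m ⊗ n)) -> u =1 v.
Proof.
move=> uD vD uv; apply: tens_ind => // [|x y ux uy]; last by rewrite uD vD ux uy.
have z (w : tens -> G) : {morph w : x y / x + y} -> w 0 = 0.
  by move=> wD; apply: (addrI (w 0)); rewrite -wD !addr0.
by rewrite !z.
Qed.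

End TensorTheory.

(* Also to keep unification of canonical structures from diverging. *)
#[global] Opaque tens.

HB.mixin Record Lmodule_isBimodule (A : pzRingType) M of GRing.Lmodule A M := {
  rscale : M -> A -> M;
  rscaleA : forall x a b, rscale (rscale x a) b = rscale x (a * b);
  rscale1 : forall x, rscale x 1 = x;
  rscaleDl : forall x y a, rscale (x + y) a = rscale x a + rscale y a;
  rscaleDr : forall x a b, rscale x (a + b) = rscale x a + rscale x b;
  rscaleZl : forall a x b, rscale (a *: x) b = a *: rscale x b
}.

#[short(type="bimodType")]
HB.structure Definition Bimodule (A : pzRingType) :=
  {M of GRing.Lmodule A M & Lmodule_isBimodule A M}.

Notation "x :*r a" := (rscale x a) : ring_scope.

Section RegularBimodule.
Variable A : pzRingType.
Fact regular_rscaleA (x : A^o) (a b : A) : (x : A) * a * b = x * (a * b) :> A.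
Proof. by rewrite mulrA. Qed.
Fact regular_rscale1 (x : A^o) : (x : A) * 1 = x :> A.
Proof. by rewrite mulr1. Qed.
Fact regular_rscaleDl (x y : A^o) (a : A) :
  ((x + y : A^o) : A) * a = x * a + y * a :> A.
Proof. exact: mulrDl. Qed.
Fact regular_rscaleDr (x : A^o) (a b : A) :
  (x : A) * (a + b) = x * a + x * b :> A.
Proof. by rewrite mulrDr. Qed.
Fact regular_rscaleZl (a : A) (x : A^o) (b : A) :
  ((a *: x : A^o) : A) * b = a *: (((x : A) * b : A) : A^o) :> A.
Proof. by rewrite /GRing.scale /= mulrA. Qed.
HB.instance Definition _ := @Lmodule_isBimodule.Build A A^o
  (fun x a => (x : A) * a) regular_rscaleA regular_rscale1 regular_rscaleDl
  regular_rscaleDr regular_rscaleZl.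
End RegularBimodule.

Definition bimod_map (A : pzRingType) (M N : bimodType A) (f : M -> N) : Prop :=
  linear f /\ forall x a, f (x :*r a) = f x :*r a.

Definition tensA (A : pzRingType) (M N : bimodType A) : Type :=
  tens (@rscale A M) (@GRing.scale A N).

Notation "M ⊗_ A N" := (@tensA A M N) : type_scope.
Notation "x ⊗ y" := (tpure (@rscale _ _) (@GRing.scale _ _) x y) : ring_scope.

Section TensorBimodule.
Variables (A : pzRingType) (M N : bimodType A).
Local Notation MN := (M ⊗_A N).

HB.instance Definition _ := GRing.Zmodule.on MN.

Lemma tensA_ext (G : zmodType) (u v : MN -> G) :
  {morph u : x y / x + y} -> {morph v : x y / x + y} ->
  (forall m n, u (m ⊗ n) = v (m ⊗ n)) -> u =1 v.
Proof. exact: tens_ext. Qed.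

Definition tscale (a : A) : MN -> MN := tlift (fun (m : M) (n : N) => (a *: m) ⊗ n).

Definition trscale (t : MN) (a : A) : MN :=
  tlift (fun (m : M) (n : N) => m ⊗ (n :*r a)) t.

Fact tscale_balanced a :
  balanced (@rscale A M) (@GRing.scale A N) (fun m n => (a *: m) ⊗ n).
Proof.
split=> [m m' n|m n n'|m r n]; first by rewrite scalerDr tpureDl.
  by rewrite tpureDr.
by rewrite -rscaleZl tpureA.
Qed.

Fact trscale_balanced a :
  balanced (@rscale A M) (@GRing.scale A N) (fun m n => m ⊗ (n :*r a)).
Proof.
split=> [m m' n|m n n'|m r n]; first by rewrite tpureDl.
  by rewrite rscaleDl tpureDr.
by rewrite rscaleZl tpureA.
Qed.

Fact tscaleD a : {morph tscale a : x y / x + y}.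
Proof. exact: tliftD (tscale_balanced a). Qed.
Fact tscaleE a m n : tscale a (m ⊗ n) = (a *: m) ⊗ n.
Proof. exact: tliftE (tscale_balanced a) _ _. Qed.
Fact trscaleD a : {morph trscale^~ a : x y / x + y}.
Proof. exact: tliftD (trscale_balanced a). Qed.
Fact trscaleE a m n : trscale (m ⊗ n) a = m ⊗ (n :*r a).
Proof. exact: tliftE (trscale_balanced a) _ _. Qed.

Fact tscaleA a b (t : MN) : tscale a (tscale b t) = tscale (a * b) t.
Proof.
apply: (tensA_ext (u := fun t => tscale a (tscale b t)) (v := tscale (a * b)))
  => [x y|x y|m n]; by rewrite ?tscaleD ?tscaleE ?scalerA.
Qed.
Fact tscale1 : left_id 1 tscale.
Proof.
by apply: tensA_ext => [x y|x y|m n]; rewrite ?tscaleD ?tscaleE ?scale1r.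
Qed.
Fact tscaleDr : right_distributive tscale +%R.
Proof. by move=> a x y; rewrite tscaleD. Qed.
Fact tscaleDl (t : MN) : {morph tscale^~ t : a b / a + b}.
Proof.
move=> a b; apply: (tensA_ext (u := tscale (a + b)) (v := fun t => tscale a t + tscale b t))
  => [x y|x y|m n].
- by rewrite tscaleD.
- by rewrite !tscaleD addrACA.
- by rewrite !tscaleE scalerDl tpureDl.
Qed.
HB.instance Definition _ :=
  GRing.Zmodule_isLmodule.Build A MN tscaleA tscale1 tscaleDr tscaleDl.

Fact trscaleA (t : MN) a b : trscale (trscale t a) b = trscale t (a * b).
Proof.
apply: (tensA_ext (u := fun t => trscale (trscale t a) b) (v := trscale^~ (a * b)))
  => [x y|x y|m n]; by rewrite ?trscaleD ?trscaleE ?rscaleA.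
Qed.
Fact trscale1 (t : MN) : trscale t 1 = t.
Proof.
apply: (tensA_ext (u := trscale^~ 1) (v := id)) => [x y|x y|m n];
  by rewrite ?trscaleD ?trscaleE ?rscale1.
Qed.
Fact trscaleDr (t : MN) a b : trscale t (a + b) = trscale t a + trscale t b.
Proof.
apply: (tensA_ext (u := trscale^~ (a + b)) (v := fun t => trscale t a + trscale t b))
  => [x y|x y|m n].
- by rewrite trscaleD.
- by rewrite !trscaleD addrACA.
- by rewrite !trscaleE rscaleDr tpureDr.
Qed.
Fact trscaleZl a (t : MN) b : trscale (a *: t) b = a *: trscale t b.
Proof.
rewrite /GRing.scale /=.
apply: (tensA_ext (u := fun t => trscale (tscale a t) b)
                 (v := fun t => tscale a (trscale t b)))
  => [x y|x y|m n]; by rewrite ?(tscaleD, trscaleD) ?(tscaleE, trscaleE).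
Qed.
HB.instance Definition _ := Lmodule_isBimodule.Build A MN
  trscaleA trscale1 (fun x y a => trscaleD a x y) trscaleDr trscaleZl.

Lemma scale_pure a (m : M) (n : N) : a *: (m ⊗ n : MN) = (a *: m) ⊗ n.
Proof. exact: tscaleE. Qed.

Lemma rscale_pure (m : M) (n : N) a : (m ⊗ n : MN) :*r a = m ⊗ (n :*r a).
Proof. exact: trscaleE. Qed.

End TensorBimodule.

Section TensorMaps.
Variable A : pzRingType.
Implicit Types M N P Q : bimodType A.

Definition tmap M N P Q (f : M -> P) (h : N -> Q) : M ⊗_A N -> P ⊗_A Q :=
  tlift (fun m n => f m ⊗ h n).

Definition tassoc1 M N P (p : P) : M ⊗_A N -> M ⊗_A (N ⊗_A P) :=
  tlift (fun (m : M) (n : N) => m ⊗ (n ⊗ p : N ⊗_A P)).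

Definition tassoc M N P : (M ⊗_A N) ⊗_A P -> M ⊗_A (N ⊗_A P) :=
  tlift (fun (t : M ⊗_A N) (p : P) => tassoc1 p t).

Definition tlunit M : A^o ⊗_A M -> M := tlift (fun (a : A^o) (m : M) => (a : A) *: m).

Definition trunit M : M ⊗_A A^o -> M := tlift (fun (m : M) (a : A^o) => m :*r (a : A)).

Lemma tmap_balanced M N P Q (f : M -> P) (h : N -> Q) :
  bimod_map f -> bimod_map h ->
  balanced (@rscale A M) (@GRing.scale A N) (fun m n => f m ⊗ h n).
Proof.
have addP (X Y : bimodType A) (u : X -> Y) : linear u -> {morph u : x y / x + y}.
  by move=> ul x y; rewrite -{1}[x]scale1r ul scale1r.
have scaleP (X Y : bimodType A) (u : X -> Y) :
    linear u -> forall a x, u (a *: x) = a *: u x.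
  move=> ul a x; have u0 : u 0 = 0.
    by apply: (addrI (u 0)); rewrite -addP // !addr0.
  by rewrite -[a *: x]addr0 ul u0 addr0.
move=> [fl fr] [hl hr]; split=> [m m' n|m n n'|m r n].
- by rewrite addP // tpureDl.
- by rewrite addP // tpureDr.
- by rewrite fr scaleP // tpureA.
Qed.

Lemma tassoc1_balanced M N P (p : P) :
  balanced (@rscale A M) (@GRing.scale A N)
    (fun (m : M) (n : N) => (m ⊗ (n ⊗ p : N ⊗_A P) : M ⊗_A (N ⊗_A P))).
Proof.
split=> [m m' n|m n n'|m r n]; first by rewrite tpureDl.
  by rewrite tpureDl tpureDr.
by rewrite -scale_pure tpureA.
Qed.

Lemma tassoc1D M N P (p : P) : {morph @tassoc1 M N P p : x y / x + y}.
Proof. exact: tliftD (tassoc1_balanced M N p). Qed.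

Lemma tassoc1E M N P (p : P) (m : M) (n : N) :
  tassoc1 p (m ⊗ n : M ⊗_A N) = m ⊗ (n ⊗ p : N ⊗_A P).
Proof. exact: tliftE (tassoc1_balanced M N p) _ _. Qed.

Lemma tassoc_balanced M N P :
  balanced (@rscale A (M ⊗_A N)) (@GRing.scale A P)
    (fun (t : M ⊗_A N) (p : P) => tassoc1 p t).
Proof.
split=> [s t p|t p p'|t r p].
- exact: tassoc1D.
- apply: (tensA_ext (u := tassoc1 (p + p')) (v := fun t => tassoc1 p t + tassoc1 p' t))
    => [x y|x y|m n].
  + exact: tassoc1D.
  + by rewrite /= !tassoc1D addrACA.
  + by rewrite !tassoc1E !tpureDr.
- apply: (tensA_ext (u := fun t : M ⊗_A N => tassoc1 p (t :*r r))
                   (v := tassoc1 (r *: p))) => [x y|x y|m n].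
  + by rewrite rscaleDl tassoc1D.
  + exact: tassoc1D.
  + by rewrite rscale_pure !tassoc1E tpureA.
Qed.

Lemma tlunit_balanced M :
  balanced (@rscale A A^o) (@GRing.scale A M) (fun (a : A^o) (m : M) => (a : A) *: m).
Proof.
by split=> [a b m|a m n|a r m]; rewrite ?scalerDl ?scalerDr ?scalerA.
Qed.

Lemma trunit_balanced M :
  balanced (@rscale A M) (@GRing.scale A A^o) (fun (m : M) (a : A^o) => m :*r (a : A)).
Proof.
by split=> [m n a|m a b|m r a]; rewrite ?rscaleDl ?rscaleDr ?rscaleA.
Qed.

End TensorMaps.

HB.mixin Record Bimodule_isCoring (A : pzRingType) C of Bimodule A C := {
  comul : C -> C ⊗_A C;
  counit : C -> A^o;
  comul_bimod : bimod_map comul;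
  counit_bimod : bimod_map counit;
  comulA : forall c : C,
    tassoc (tmap comul idfun (comul c)) = tmap idfun comul (comul c);
  counitl : forall c : C, tlunit (tmap counit idfun (comul c)) = c;
  counitr : forall c : C, trunit (tmap idfun counit (comul c)) = c
}.

#[short(type="coringType")]
HB.structure Definition Coring (A : pzRingType) :=
  {C of Bimodule A C & Bimodule_isCoring A C}.

Definition coring_map (A : pzRingType) (C D : coringType A) (f : C -> D) : Prop :=
  [/\ bimod_map f, forall c, comul (f c) = tmap f f (comul c) &
      forall c, counit (f c) = counit c].

Record coring_aut (A : pzRingType) (C : coringType A) := CoringAut {
  aut_fun :> C -> C;
  aut_map : coring_map aut_fun;
  aut_bij : bijective aut_fun
}.

Lemma coring_autP (A : pzRingType) (C : coringType A) (f h : coring_aut C) :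
  f =1 h -> f = h.
Proof.
case: f h => [f fm fb] [h hm hb] /= fh.
have e : f = h by apply/funext.
by subst h; congr CoringAut; apply: Prop_irrelevance.
Qed.

HB.instance Definition _ (A : pzRingType) (C : coringType A) :=
  gen_eqMixin (coring_aut C).
HB.instance Definition _ (A : pzRingType) (C : coringType A) :=
  gen_choiceMixin (coring_aut C).

Section AutGroup.
Variables (A : pzRingType) (C : coringType A).
Implicit Types f h k : coring_aut C.

Fact bimod_map_id : bimod_map (idfun : C -> C).
Proof. by []. Qed.

Fact bimod_map_comp (u v : C -> C) : bimod_map u -> bimod_map v -> bimod_map (u \o v).
Proof.
move=> [ul ur] [vl vr]; split=> [a x y|x a] /=; first by rewrite vl ul.
by rewrite vr ur.
Qed.

Fact bimod_map_can (u v : C -> C) :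
  cancel u v -> cancel v u -> bimod_map u -> bimod_map v.
Proof.
move=> uv vu [ul ur]; split=> [a x y|x a]; apply: (can_inj uv).
  by rewrite vu ul !vu.
by rewrite vu ur vu.
Qed.

Fact tmap_id (t : C ⊗_A C) : tmap idfun idfun t = t.
Proof.
have b := tmap_balanced bimod_map_id bimod_map_id.
by apply: (tensA_ext (u := tmap idfun idfun) (v := id)) => // [x y|m n];
  rewrite /tmap ?(tliftD b) ?(tliftE b).
Qed.

Fact tmap_comp (u v : C -> C) (t : C ⊗_A C) : bimod_map u -> bimod_map v ->
  tmap (u \o v) (u \o v) t = tmap u u (tmap v v t).
Proof.
move=> ub vb; have buv := tmap_balanced (bimod_map_comp ub vb) (bimod_map_comp ub vb).
have bu := tmap_balanced ub ub; have bv := tmap_balanced vb vb.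
apply: (tensA_ext (u := tmap (u \o v) (u \o v)) (v := fun t => tmap u u (tmap v v t)))
  => [x y|x y|m n]; rewrite /tmap.
- by rewrite (tliftD buv).
- by rewrite (tliftD bv) (tliftD bu).
- by rewrite (tliftE buv) (tliftE bv) (tliftE bu).
Qed.

Fact aut1_map : coring_map (idfun : C -> C).
Proof. by split=> // c; rewrite tmap_id. Qed.

Definition aut1 : coring_aut C := CoringAut aut1_map (Bijective (fun=> erefl) (fun=> erefl)).

Fact autM_map f h : coring_map (f \o h).
Proof.
case: f h => [f [fb fD fe] ?] [h [hb hD he] ?] /=.
split; first exact: bimod_map_comp.
  by move=> c; rewrite /= fD hD tmap_comp.
by move=> c; rewrite /= fe he.
Qed.

Definition autM f h : coring_aut C :=
  CoringAut (autM_map f h) (bij_comp (aut_bij f) (aut_bij h)).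

Fact aut_inv_subproof f : exists v, cancel f v /\ cancel v f.
Proof. by case: (aut_bij f) => v fv vf; exists v. Qed.

Definition aut_invfun f : C -> C := sval (cid (aut_inv_subproof f)).

Fact aut_invfunK f : cancel f (aut_invfun f).
Proof. by rewrite /aut_invfun; case: cid => v []. Qed.

Fact aut_invfunVK f : cancel (aut_invfun f) f.
Proof. by rewrite /aut_invfun; case: cid => v []. Qed.

Fact autV_map f : coring_map (aut_invfun f).
Proof.
case: (aut_map f) => fb fD fe; have fK := aut_invfunK f; have Kf := aut_invfunVK f.
have vb := bimod_map_can fK Kf fb.
split=> // c; last by rewrite -{2}[c]Kf fe.
rewrite -{2}[c]Kf fD -tmap_comp //.
by have -> : aut_invfun f \o f = idfun; [apply/funext | rewrite tmap_id].
Qed.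

Definition autV f : coring_aut C :=
  CoringAut (autV_map f) (Bijective (aut_invfunVK f) (aut_invfunK f)).

Fact autMA : associative autM.
Proof. by move=> f h k; apply: coring_autP. Qed.
Fact aut1M : left_id aut1 autM.
Proof. by move=> f; apply: coring_autP. Qed.
Fact autM1 : right_id aut1 autM.
Proof. by move=> f; apply: coring_autP. Qed.
Fact autVM : left_inverse aut1 autV autM.
Proof. by move=> f; apply: coring_autP => c; apply: aut_invfunK. Qed.
Fact autMV : right_inverse aut1 autV autM.
Proof. by move=> f; apply: coring_autP => c; apply: aut_invfunVK. Qed.

HB.instance Definition _ := isGroup.Build (coring_aut C) autMA aut1M autM1 autVM autMV.

End AutGroup.

Section Grouplike.
Variables (A : pzRingType) (C : coringType A).
Implicit Types (g h : C) (a b : A) (u : units A).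

Definition grouplike : set C := [set g | comul g = g ⊗ g /\ counit g = 1].

Definition uconj u g : C := (uval u *: g) :*r uinv u.

Lemma uconjM u v g : uconj (u * v)%g g = uconj u (uconj v g).
Proof. by rewrite /uconj /= -scalerA -rscaleA !rscaleZl. Qed.

Lemma grouplike_uconj u g : grouplike g -> grouplike (uconj u g).
Proof.
have biZ (N : bimodType A) (f : C -> N) : bimod_map f ->
    f (uconj u g) = (uval u *: f g) :*r uinv u.
  move=> [fl fr]; have f0 : f 0 = 0.
    by have := fl (-1) 0 0; rewrite scaleN1r oppr0 addr0 scaleN1r addNr.
  by rewrite /uconj fr -[_ *: g]addr0 fl f0 addr0.
case=> gD ge; split; last first.
  rewrite (biZ _ _ counit_bimod) ge.
  by transitivity (uval u * 1 * uinv u : A); last by rewrite mulr1 uvalV.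
rewrite (biZ _ _ comul_bimod) gD scale_pure rscale_pure /uconj.
by rewrite tpureA !rscaleZl scalerA uVval scale1r.
Qed.

Definition gorbit g : set C := [set uconj u g | u in [set: units A]].

(* The underlying set of the pointed set 𝒟¹(C, g), whose base point is gorbit g;
   it is trivial when D1 C = [set gorbit g]. *)
Definition D1 : set (set C) := [set gorbit h | h in grouplike].

Definition cent g : set A := [set a | a *: g = g :*r a].

Definition cent_pred g : {pred A} := fun a => `[< cent g a >].

Fact cent_closed g : subring_closed (cent_pred g).
Proof.
split=> [|a b /asboolP ga /asboolP gb|a b /asboolP ga /asboolP gb]; apply/asboolP.
- by rewrite /cent /= scale1r rscale1.
- rewrite /cent /= in ga gb *; rewrite scalerBl ga gb.
  by apply/eqP; rewrite subr_eq -rscaleDr subrK.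
- by rewrite /cent /= in ga gb *; rewrite -scalerA gb -rscaleZl ga rscaleA.
Qed.

Definition cent_ring g : Type := {a : A | a \in cent_pred g}.
HB.instance Definition _ g := SubChoice.on (cent_ring g).
HB.instance Definition _ g :=
  GRing.SubChoice_isSubPzRing.Build A (cent_pred g) (cent_ring g) (cent_closed g).

(* A ⊗_(A^g) A *)
Definition cent_tens g : zmodType :=
  tens (fun (a : A) (b : cent_ring g) => a * val b)
       (fun (b : cent_ring g) (a : A) => val b * a).

Definition can_map g : cent_tens g -> C := tlift (fun a a' : A => a *: g :*r a').

Lemma can_map_balanced g :
  balanced (fun (a : A) (b : cent_ring g) => a * val b)
    (fun (b : cent_ring g) (a : A) => val b * a) (fun a a' : A => a *: g :*r a').
Proof.
split=> [a b c|a b c|a [b /= /asboolP gb] c].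
- by rewrite scalerDl rscaleDl.
- by rewrite rscaleDr.
- by rewrite -rscaleA -scalerA gb !rscaleZl.
Qed.

Definition galois g : Prop := bijective (@can_map g).

Definition unorm_pred g : {pred units A} := fun u =>
  `[< [set uval u * b | b in cent g]%classic = [set b * uval u | b in cent g]%classic >].

Lemma unormP g u : reflect
  ((forall b, cent g b -> exists2 c, cent g c & uval u * b = c * uval u) /\
   (forall b, cent g b -> exists2 c, cent g c & b * uval u = uval u * c))
  (u \in unorm_pred g).
Proof.
apply: (iffP (asboolP _)) => [e|[h1 h2]].
  split=> b gb.
    have : [set uval u * b | b in cent g]%classic (uval u * b) by exists b.
    by rewrite e => -[c gc ec]; exists c.
  have : [set b * uval u | b in cent g]%classic (b * uval u) by exists b.
  by rewrite -e => -[c gc ec]; exists c.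
apply/seteqP; split=> _ [b gb <-].
  by have [c gc ->] := h1 b gb; exists c.
by have [c gc ->] := h2 b gb; exists c.
Qed.

Fact unorm_closed g : group_closed (unorm_pred g).
Proof.
split; first by apply/unormP; split=> b gb; exists b; rewrite //= mul1r mulr1.
move=> u v /unormP[u1 u2] /unormP[v1 v2]; apply/unormP; split=> b gb /=.
  have [c gc e] := v2 b gb; have [d gd e'] := u1 c gc; exists d => //.
  have -> : uval u * uinv v * b = uval u * c * uinv v.
    rewrite -!mulrA; congr (_ * _); rewrite -[b in LHS]mulr1 -(uvalV v).
    by rewrite [b * _]mulrA e !mulrA uVval mul1r.
  by rewrite e' mulrA.
have [c gc e] := u2 b gb; have [d gd e'] := v1 c gc; exists d => //.
rewrite mulrA e -!mulrA; congr (_ * _).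
rewrite -[c in LHS]mul1r -(uVval v) -[_ * _ * c]mulrA e'.
by rewrite -!mulrA uvalV mulr1.
Qed.

(* U(A)_g *)
Definition unorm g : Type := {u : units A | u \in unorm_pred g}.
HB.instance Definition _ g := SubChoice.on (unorm g).
HB.instance Definition _ g :=
  SubChoice_isSubGroup.Build (units A) (unorm_pred g) (unorm g) (unorm_closed g).

(* The image of U(A^g) in U(A)_g *)
Definition ucent g : {pred unorm g} := fun x =>
  `[< exists v : units (cent_ring g), val (uval v) = uval (val x) >].

Lemma ucentP g (u : unorm g) :
  reflect (cent g (uval (val u)) /\ cent g (uinv (val u))) (u \in @ucent g).
Proof.
apply: (iffP (asboolP _)) => [[v ev]|[gu gu']].
  have ev' : val (uinv v) = uinv (val u).
    rewrite -[LHS]mulr1 -(uvalV (val u)) mulrA -ev -rmorphM uVval rmorph1.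
    by rewrite mul1r.
  rewrite -ev -ev'; split; first exact: asboolW (valP (uval v)).
  exact: asboolW (valP (uinv v)).
pose a : cent_ring g := @exist A _ (uval (val u)) (asboolT gu).
pose b : cent_ring g := @exist A _ (uinv (val u)) (asboolT gu').
have ab : a * b = 1 by apply: val_inj; rewrite rmorphM rmorph1; apply: uvalV.
have ba : b * a = 1 by apply: val_inj; rewrite rmorphM rmorph1; apply: uVval.
by exists (Units ab ba).
Qed.

Fact ucent_closed g : group_closed (@ucent g).
Proof.
have M b c : cent g b -> cent g c -> cent g (b * c).
  move=> gb gc; have [_ _ h] := cent_closed g.
  exact: asboolW (h b c (asboolT gb) (asboolT gc)).
split.
  by apply/ucentP; rewrite gmulf1 /=; split; case: (cent_closed g) => /asboolW.
move=> u v /ucentP[gu gu'] /ucentP[gv gv']; apply/ucentP.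
by rewrite gmulfF; split; apply: M.
Qed.

Fact ucent_normal g (x y : unorm g) : x \in @ucent g -> (x ^ y)%g \in @ucent g.
Proof.
have J (v : units A) b : v \in unorm_pred g -> cent g b -> cent g (uinv v * b * uval v).
  case/unormP=> _ h gb; have [c gc e] := h b gb.
  by rewrite -mulrA e mulrA uVval mul1r.
case/ucentP=> gx gx'; apply/ucentP; rewrite gmulfJ /conjg /=.
by rewrite mulrA; split; apply: J => //; apply: valP.
Qed.

HB.instance Definition _ g := isMulClosed.Build (unorm g) (@ucent g)
  (group_closedM (ucent_closed g)).
HB.instance Definition _ g := isMul1Closed.Build (unorm g) (@ucent g)
  (ucent_closed g).1.
HB.instance Definition _ g := isInvClosed.Build (unorm g) (@ucent g)
  (group_closedV (ucent_closed g)).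
HB.instance Definition _ g := isNormalized.Build (unorm g) (@ucent g)
  (@ucent_normal g).

End Grouplike.

Arguments D1 {A} C.
Arguments cent_pred {A C} g.
Arguments cent_ring {A C} g.
Arguments can_map {A C} g.
Arguments unorm {A C} g.
Arguments ucent {A C} g.

(* Main.v *)
Require Import Defs.
From HB Require Import structures.
From mathcomp Require Import all_boot all_algebra.
From mathcomp Require Import boolp classical_sets.

Set Implicit Arguments.
Unset Strict Implicit.
Unset Printing Implicit Defensive.

Import GRing.Theory.
Local Open Scope ring_scope.

(** A Galois grouplike g makes C a bimodule with one generator g whose only
relations are b g = g b for b in A^g. So a bimodule map out of C is determined
by the image of g ([galois_bimod_map_ext]), any x centralised by A^g is such an
image ([galois_bimod_map]), and the map with g |-> x is a map of corings as soon
as x is grouplike ([galois_coring_map]).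

An automorphism f sends g to a grouplike, which, there being one orbit, is
u g u^-1 for some unit u. Since f is injective, g and u g u^-1 have the same
centraliser, that is, u normalises A^g ([aut_image]); conversely each u in
U(A)_g comes from an automorphism ([unorm_aut]), with inverse the map attached
to u^-1. Two units give the same image u g u^-1 exactly when they differ by an
element of U(A^g) ([uconj_gquot]), so f |-> u induces a bijection from Aut(C) to
U(A)_g / U(A^g). As f (h g) = f (v g v^-1) = (v u) g (v u)^-1 when h corresponds
to v, this bijection reverses products, and the isomorphism is f |-> [u^-1]. *)

(** * Bimodule maps *)

Section BimodMap.
Variables (A : pzRingType) (M N : bimodType A) (f : M -> N).
Hypothesis fb : bimod_map f.

Lemma bimod_mapD : {morph f : x y / x + y}.
Proof. by move=> x y; case: fb => fl _; rewrite -{1}[x]scale1r fl scale1r. Qed.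

Lemma bimod_mapZ a x : f (a *: x) = a *: f x.
Proof.
have f0 : f 0 = 0 by apply: (addrI (f 0)); rewrite -bimod_mapD !addr0.
by case: fb => fl _; rewrite -[a *: x]addr0 fl f0 addr0.
Qed.

Lemma bimod_mapZr x a : f (x :*r a) = f x :*r a.
Proof. by case: fb. Qed.

End BimodMap.

Lemma comp_bimod_map (A : pzRingType) (M N P : bimodType A)
  (f : N -> P) (h : M -> N) : bimod_map f -> bimod_map h -> bimod_map (f \o h).
Proof.
by move=> [fl fr] [hl hr]; split=> [a x y|x a] /=; rewrite ?hl ?fl ?hr ?fr.
Qed.

Lemma tmap_bimod_map (A : pzRingType) (M N P Q : bimodType A)
  (f : M -> P) (h : N -> Q) :
  bimod_map f -> bimod_map h -> bimod_map (tmap f h).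
Proof.
move=> fb hb; have bal := tmap_balanced fb hb.
have tD : {morph tmap f h : x y / x + y} by exact: tliftD bal.
split=> [a x y|x a].
  rewrite tD; congr (_ + _); move: x.
  apply: (tensA_ext (u := fun t => tmap f h (a *: t))
                    (v := fun t => a *: tmap f h t)) => [x z|x z|m n].
  - by rewrite scalerDr tD.
  - by rewrite tD scalerDr.
  - by rewrite scale_pure /tmap !(tliftE bal) scale_pure bimod_mapZ.
move: x; apply: (tensA_ext (u := fun t => tmap f h (t :*r a))
                           (v := fun t => tmap f h t :*r a)) => [x z|x z|m n].
- by rewrite rscaleDl tD.
- by rewrite tD rscaleDl.
- by rewrite rscale_pure /tmap !(tliftE bal) rscale_pure bimod_mapZr.
Qed.

(** * The universal property of a Galois grouplike *)

Section Galois.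
Variables (A : pzRingType) (C : coringType A) (g : C).
Hypothesis g_galois : galois g.

Lemma can_mapE a b : can_map g (tpure _ _ a b) = a *: g :*r b.
Proof. exact: tliftE (can_map_balanced g) _ _. Qed.

Lemma can_mapD : {morph can_map g : x y / x + y}.
Proof. exact: tliftD (can_map_balanced g). Qed.

(** Surjectivity of the canonical map: g generates C. *)
Lemma galois_ext (G : zmodType) (u v : C -> G) :
  {morph u : x y / x + y} -> {morph v : x y / x + y} ->
  (forall a b, u (a *: g :*r b) = v (a *: g :*r b)) -> u =1 v.
Proof.
move=> uD vD uv c; case: g_galois => k _ canK; rewrite -[c]canK.
move: (k c); apply: tens_ext => [x y|x y|a b]; rewrite ?can_mapE //.
  by rewrite can_mapD uD.
by rewrite can_mapD vD.
Qed.

Lemma galois_bimod_map_ext (M : bimodType A) (u v : C -> M) :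
  bimod_map u -> bimod_map v -> u g = v g -> u =1 v.
Proof.
move=> ub vb uv; apply: galois_ext => [||a b]; try exact: bimod_mapD.
by rewrite !bimod_mapZr // !bimod_mapZ // uv.
Qed.

(** Injectivity of the canonical map: g has no relations other than those that
define A^g. *)
Lemma galois_bimod_map (M : bimodType A) (x : M) :
  (forall b, cent g b -> b *: x = x :*r b) ->
  exists2 f : C -> M, bimod_map f & f g = x.
Proof.
move=> xc; case: g_galois => k kK canK.
pose phi (a b : A) : M := a *: x :*r b.
have bal : balanced (fun (a : A) (b : cent_ring g) => a * val b)
    (fun (b : cent_ring g) (a : A) => val b * a) phi.
  rewrite /phi; split=> [a b c|a b c|a [b /= /asboolP gb] c].
  - by rewrite scalerDl rscaleDl.
  - by rewrite rscaleDr.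
  - by rewrite -rscaleA -scalerA xc // !rscaleZl.
have kD : {morph k : c d / c + d}.
  by move=> c d; apply: (can_inj kK); rewrite can_mapD !canK.
have kE a b : k (a *: g :*r b) = tpure _ _ a b by rewrite -can_mapE kK.
pose f c := tlift phi (k c).
have fD : {morph f : c d / c + d} by move=> c d; rewrite /f kD (tliftD bal).
have fE a b : f (a *: g :*r b) = a *: x :*r b by rewrite /f kE (tliftE bal).
exists f; last by rewrite -[g]scale1r -[_ *: _]rscale1 fE rscale1 scale1r.
split=> [a c d|c a].
  rewrite fD; congr (_ + _); move: c.
  apply: (galois_ext (u := fun c => f (a *: c)) (v := fun c => a *: f c)).
  - by move=> c e; rewrite scalerDr fD.
  - by move=> c e; rewrite fD scalerDr.
  - by move=> b e; rewrite -rscaleZl scalerA !fE -scalerA rscaleZl.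
move: c; apply: (galois_ext (u := fun c => f (c :*r a)) (v := fun c => f c :*r a)).
- by move=> c e; rewrite rscaleDl fD.
- by move=> c e; rewrite fD rscaleDl.
- by move=> b e; rewrite rscaleA !fE rscaleA.
Qed.

(** Compatibility with the comultiplications and the counits is an equality of
bimodule maps on C, hence holds once it holds at g, where it says that g and its
image are grouplike. *)
Lemma galois_coring_map (D : coringType A) (h : D) :
  grouplike g -> grouplike h -> (forall b, cent g b -> cent h b) ->
  exists2 f : C -> D, coring_map f & f g = h.
Proof.
move=> [gD ge] [hD he] gh; have [f fb fg] := galois_bimod_map gh.
exists f => //; split=> // c.
  apply: (galois_bimod_map_ext (u := comul \o f) (v := tmap f f \o comul)) c => /=.
  - exact: comp_bimod_map comul_bimod fb.
  - by apply: comp_bimod_map comul_bimod; apply: tmap_bimod_map.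
  - by rewrite gD fg hD /tmap (tliftE (tmap_balanced fb fb)) fg.
apply: (galois_bimod_map_ext (u := counit \o f) (v := counit)) c => /=.
- exact: comp_bimod_map counit_bimod fb.
- exact: counit_bimod.
- by rewrite fg he ge.
Qed.

End Galois.

(** * Conjugation by units *)

Section Conjugation.
Variables (A : pzRingType) (C : coringType A) (g : C).

Lemma cent_uconj (u : units A) b :
  cent (uconj u g) b <-> cent g (uinv u * b * uval u).
Proof.
rewrite /cent /uconj /=; split=> e.
  have := congr1 (fun x => uinv u *: x :*r uval u) e.
  by rewrite /= -!rscaleZl !scalerA !rscaleA uVval scale1r rscale1 !mulrA.
rewrite -!rscaleZl !scalerA rscaleA.
have -> : b * uval u = uval u * (uinv u * b * uval u).
  by rewrite !mulrA uvalV mul1r.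
rewrite -scalerA e -rscaleZl rscaleA; congr (_ :*r _).
by rewrite -!mulrA uvalV mulr1.
Qed.

(** The centraliser of u g u^-1 is u A^g u^-1. *)
Lemma unorm_cent_uconj (u : units A) :
  u \in unorm_pred g <-> (forall b, cent g b <-> cent (uconj u g) b).
Proof.
split=> [/unormP[u1 u2] b|e].
  rewrite cent_uconj; split=> gb.
    by have [c gc ec] := u2 b gb; rewrite -mulrA ec mulrA uVval mul1r.
  have [c gc ec] := u1 _ gb; suff -> : b = c by [].
  by rewrite -[b]mulr1 -[c]mulr1 -(uvalV u) !mulrA -ec !mulrA uvalV mul1r.
apply/unormP; split=> b gb.
  exists (uval u * b * uinv u); last by rewrite -mulrA uVval mulr1.
  by apply/e/cent_uconj; rewrite !mulrA uVval mul1r -mulrA uVval mulr1.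
exists (uinv u * b * uval u); last by rewrite !mulrA uvalV mul1r.
by apply/cent_uconj/e.
Qed.

Lemma uconj1 : uconj 1%g g = g.
Proof. by rewrite /uconj scale1r rscale1. Qed.

Lemma uconjK (u : units A) : cancel (@uconj A C u) (uconj u^-1%g).
Proof. by move=> x; rewrite -uconjM mulVg /uconj scale1r rscale1. Qed.

Lemma bimod_map_uconj (M : coringType A) (f : C -> M) (u : units A) :
  bimod_map f -> f (uconj u g) = uconj u (f g).
Proof. by move=> fb; rewrite /uconj bimod_mapZr // bimod_mapZ. Qed.

(** If w g w^-1 = g then w commutes with g, and so does w^-1: the unit w of A
is a unit of A^g. *)
Lemma ucent_uconj (w : unorm g) : w \in ucent g <-> uconj (val w) g = g.
Proof.
split=> [/ucentP[gw _]|e].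
  by rewrite /uconj gw rscaleA uvalV rscale1.
have c (u : units A) : uconj u g = g -> cent g (uval u).
  by move=> eu; rewrite /cent /= -{2}eu /uconj rscaleA uVval rscale1.
apply/ucentP; split; first exact: c.
by apply: (c (val w)^-1%g); have := uconjK (val w) g; rewrite e.
Qed.

Lemma uconj_gquot (u v : unorm g) :
  uconj (val u) g = uconj (val v) g <->
  \pi_(gquot (ucent g))%qT u^-1%g = \pi_(gquot (ucent g))%qT v^-1%g.
Proof.
have -> : uconj (val u) g = uconj (val v) g <-> (v^-1 * u)%g \in ucent g.
  rewrite ucent_uconj gmulfM gmulfV uconjM; split=> [->|e]; first exact: uconjK.
  by apply: (can_inj (uconjK (val v)^-1%g)); rewrite e uconjK.
(* The classes of u^-1 and v^-1 agree when u v^-1 lies in the normal subgroup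
   ucent g, which contains with it its conjugate v^-1 u. *)
split=> [h|/eqP].
  apply/eqP; rewrite piE /GQuotient.equiv invgK.
  by have := gpred_normal _ v^-1%g h; rewrite /conjg invgK mulgA mulVKg.
rewrite piE /GQuotient.equiv invgK => h.
by have := gpred_normal _ v h; rewrite /conjg mulgVK.
Qed.

End Conjugation.

(** * Automorphisms and normalising units *)

Section Automorphisms.
Variables (A : pzRingType) (C : coringType A) (g : C).

Lemma grouplike_coring_map (D : coringType A) (f : C -> D) :
  coring_map f -> grouplike g -> grouplike (f g).
Proof.
move=> [fb fD fe] [gD ge]; split; last by rewrite fe.
by rewrite fD gD /tmap (tliftE (tmap_balanced fb fb)).
Qed.

(** An automorphism preserves centralisers, so the unit that conjugates g to
its image normalises A^g. *)
Lemma aut_image (f : coring_aut C) :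
  grouplike g -> D1 C = [set gorbit g]%classic ->
  exists u : unorm g, f g = uconj (val u) g.
Proof.
move=> gg D1g; have fg := grouplike_coring_map (aut_map f) gg.
have : D1 C (gorbit (f g)) by exists (f g).
rewrite D1g /= => orb.
have : gorbit (f g) (f g) by exists 1%g; rewrite ?uconj1.
rewrite orb => -[u _ eu].
have [fb _ _] := aut_map f.
suff hu : u \in unorm_pred g by exists (exist _ u hu).
apply/unorm_cent_uconj => b; rewrite eu /cent /=.
by rewrite -(bimod_mapZ fb) -(bimod_mapZr fb); split=> [->//|/(bij_inj (aut_bij f))].
Qed.

(** The coring map with g |-> u g u^-1 is bijective because the one attached to
u^-1 composes with it to a bimodule map that fixes g. *)
Lemma unorm_aut (u : unorm g) : grouplike g -> galois g ->
  exists f : coring_aut C, f g = uconj (val u) g.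
Proof.
move=> gg gG.
have ex (v : unorm g) : exists2 f : C -> C, coring_map f & f g = uconj (val v) g.
  apply: galois_coring_map => //; first exact: grouplike_uconj.
  by move=> b; case/unorm_cent_uconj/(_ b): (valP v).
have inv (v w : unorm g) (f h : C -> C) : coring_map f -> coring_map h ->
    f g = uconj (val v) g -> h g = uconj (val w) g -> (w * v = 1)%g -> cancel h f.
  move=> [fb _ _] [hb _ _] fg hg wv.
  apply: (galois_bimod_map_ext gG (u := f \o h) (v := id)) => //=.
    exact: comp_bimod_map.
  by rewrite hg bimod_map_uconj // fg -uconjM -gmulfM wv gmulf1 uconj1.
have [f fm fg] := ex u; have [h hm hg] := ex u^-1%g.
have fK : cancel f h by apply: inv hg fg _; rewrite ?mulgV.
have hK : cancel h f by apply: inv fg hg _; rewrite ?mulVg.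
by exists (CoringAut fm (Bijective fK hK)).
Qed.

End Automorphisms.

(* A is a K-algebra through the central ring morphism iota. *)
Theorem corollary2p4
  (K : comPzRingType) (A : pzRingType) (iota : {rmorphism K -> A})
  (iota_central : forall (k : K) (a : A), iota k * a = a * iota k)
  (C : coringType A) (g : C)
  (g_grouplike : grouplike g) (g_galois : galois g)
  (D1_trivial : D1 C = [set gorbit g]%classic) :
  group_isomorphic (coring_aut C) (gquot (ucent g)).
Proof.
have [rep repE] := choice (fun f => aut_image f g_grouplike D1_trivial).
pose F f : gquot (ucent g) := \pi_(gquot (ucent g))%qT (rep f)^-1%g.
have FE f (u : unorm g) :
    F f = \pi_(gquot (ucent g))%qT u^-1%g <-> f g = uconj (val u) g.
  by rewrite -uconj_gquot repE.
have FM : {morph F : f h / (f * h)%g}.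
  move=> f h; transitivity (\pi_(gquot (ucent g))%qT ((rep h * rep f)^-1)%g).
    apply/FE; have [fb _ _] := aut_map f.
    transitivity (f (h g)); first by [].
    by rewrite (repE h) bimod_map_uconj // repE -uconjM gmulfM.
  by rewrite invgM; exact: (GQuotient.pi_mul (ucent g)).
have F_inj : injective F.
  move=> f h /FE; rewrite -repE => fh; apply: coring_autP.
  have [fb _ _] := aut_map f; have [hb _ _] := aut_map h.
  exact: (galois_bimod_map_ext g_galois fb hb).
have /choice[k FK] : forall q, exists f, F f = q.
  move=> q; have [f fE] := unorm_aut (repr q)^-1%g g_grouplike g_galois.
  by exists f; rewrite -[RHS]reprK -[repr q]invgK; apply/FE.
pose FI := isMultiplicative.Build (coring_aut C) (gquot (ucent g)) F FM.
pose Fm : {multiplicative coring_aut C -> gquot (ucent g)} :=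
  HB.pack F FI.
by exists Fm; exists k => // f; apply: F_inj; rewrite /= FK.
Qed.
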